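(* There is a function $h(n)=\Theta(n)$ such that for every integer $n\ge 8$, $$\frac12\, n^{3/2}+h(n)\le \psi'_c(K_n).$$
   Context: $K_n$ is the complete graph on $n$ vertices and $[k]=\{1,\dots,k\}$. For a finite simple graph $H$, a complete $k$-coloring of $H$ is a (not necessarily proper) map $\varsigma\colon V(H)\to[k]$ such that for each pair of different colors $i,j\in[k]$ there is an edge $xy\in E(H)$ with $x\in\varsigma^{-1}(i)$ and $y\in\varsigma^{-1}(j)$. It is connected if each color class $\varsigma^{-1}(i)$ induces a connected subgraph of $H$. For a connected graph $H$, $\psi_c(H)$ is the largest $k$ for which $H$ has a connected and complete $k$-coloring. The connected-pseudoachromatic index of a graph $G$ is $\psi'_c(G)=\psi_c(L(G))$, where $L(G)$ is the line graph of $G$. Equivalently, $\psi'_c(K_n)$ is the largest $k$ for which the edges of $K_n$ can be colored with $k$ colors so that each color class of edges forms a connected subgraph and every two color classes share at least one vertex. A real-valued function $h$ (possibly taking negative values) satisfies $h(n)=\Theta(n)$ if there are constants $c_1,c_2>0$ with $c_1 n\le |h(n)|\le c_2 n$ for all sufficiently large $n$. *)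

(* Defs.v *)
From mathcomp Require Import all_boot.

Set Implicit Arguments.
Unset Strict Implicit.
Unset Printing Implicit Defensive.

Record sgraph := SGraph {
  vertex :> finType;
  adj : rel vertex;
  adj_sym : symmetric adj;
  adj_irrefl : irreflexive adj }.

Arguments adj {s} x y.

Lemma complete_sym n : symmetric (fun x y : 'I_n => x != y).
Proof. by move=> x y; rewrite eq_sym. Qed.

Lemma complete_irrefl n : irreflexive (fun x y : 'I_n => x != y).
Proof. by move=> x; rewrite eqxx. Qed.

Definition complete_graph (n : nat) : sgraph :=
  SGraph (@complete_sym n) (@complete_irrefl n).

Definition edges (G : sgraph) : {set {set G}} :=
  [set [set p.1; p.2] | p : G * G & adj p.1 p.2].

Section LineGraph.
Variable G : sgraph.

Definition line_adj : rel {e : {set G} | e \in edges G} :=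
  fun e f => (e != f) && (val e :&: val f != set0).

Lemma line_sym : symmetric line_adj.
Proof. by move=> e f; rewrite /line_adj eq_sym setIC. Qed.

Lemma line_irrefl : irreflexive line_adj.
Proof. by move=> e; rewrite /line_adj eqxx. Qed.

Definition line_graph : sgraph := SGraph line_sym line_irrefl.

End LineGraph.

Section Induced.
Variables (G : sgraph) (A : {set G}).

Definition induced_adj : rel {x : G | x \in A} :=
  fun x y => adj (val x) (val y).

Lemma induced_sym : symmetric induced_adj.
Proof. by move=> x y; apply: adj_sym. Qed.

Lemma induced_irrefl : irreflexive induced_adj.
Proof. by move=> x; apply: adj_irrefl. Qed.

Definition induced : sgraph := SGraph induced_sym induced_irrefl.

End Induced.

(* The graph without vertices does not count as connected. *)
Definition connected_graph (G : sgraph) : bool :=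
  (0 < #|G|) && [forall x : G, forall y : G, connect adj x y].

Section Colorings.
Variables (H : sgraph) (k : nat).

Definition color_class (c : {ffun H -> 'I_k}) (i : 'I_k) : {set H} :=
  [set x | c x == i].

Definition complete_coloring (c : {ffun H -> 'I_k}) : bool :=
  [forall i : 'I_k, forall j : 'I_k, (i != j) ==>
    [exists x in color_class c i, exists y in color_class c j, adj x y]].

Definition connected_coloring (c : {ffun H -> 'I_k}) : bool :=
  [forall i : 'I_k, connected_graph (induced (color_class c i))].

Definition has_connected_complete_coloring : bool :=
  [exists c : {ffun H -> 'I_k}, connected_coloring c && complete_coloring c].

End Colorings.

(* Color classes are nonempty, so bounding the number of colors by #|H| loses
   nothing; see [psi_c_max] and [psi_c_attained]. *)
Definition psi_c (H : sgraph) : nat :=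
  \max_(k < #|H|.+1 | has_connected_complete_coloring H k) k.

Definition psi'_c (G : sgraph) : nat := psi_c (line_graph G).

Lemma connected_complete_coloring_le (H : sgraph) (k : nat) :
  has_connected_complete_coloring H k -> k <= #|H|.
Proof.
case/existsP => c /andP[/forallP conn _].
have surj i : exists x, c x == i.
  have /andP[/card_gt0P[x _] _] := conn i.
  by exists (val x); move: (valP x); rewrite inE.
pose g i := xchoose (surj i).
have gK : cancel g c by move=> i; apply/eqP; exact: (xchooseP (surj i)).
by rewrite -[X in X <= _]card_ord; apply: (leq_card g (can_inj gK)).
Qed.

Lemma psi_c_max (H : sgraph) (k : nat) :
  has_connected_complete_coloring H k -> k <= psi_c H.
Proof.
move=> Hk; have ltk : k < #|H|.+1 by rewrite ltnS connected_complete_coloring_le.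
exact: (@leq_bigmax_cond _ _ (fun i : 'I_#|H|.+1 => i : nat) (Ordinal ltk)).
Qed.

Lemma psi_c_attained (H : sgraph) :
  connected_graph H -> has_connected_complete_coloring H (psi_c H).
Proof.
case/andP => H0 /forallP Hconn.
have H1 : has_connected_complete_coloring H 1.
  apply/existsP; exists [ffun=> ord0]; apply/andP; split; last first.
    by apply/forallP => i; apply/forallP => j; rewrite !ord1 eqxx.
  apply/forallP => i.
  have inA (x : H) : x \in color_class [ffun=> ord0] i.
    by rewrite inE ffunE !ord1.
  apply/andP; split.
    by case/card_gt0P: H0 => x _; apply/card_gt0P; exists (exist _ x (inA x)).
  apply/forallP => -[x xA]; apply/forallP => -[y yA].
  have /connectP[p] := forallP (Hconn x) y.
  elim: p x xA => [|z p IH] x xA /=.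
    by move=> _ yx; subst y; rewrite (bool_irrelevance yA xA).
  case/andP => xz pz yE; apply: connect_trans (IH z (inA z) pz yE).
  by apply: connect1; rewrite /= /induced_adj /=.
have lt1 : 1 < #|H|.+1 by rewrite ltnS.
have [k Hk eqk] := eq_bigmax_cond (fun i : 'I_#|H|.+1 => i : nat)
  (A := [pred i : 'I_#|H|.+1 | has_connected_complete_coloring H i])
  (introT card_gt0P (ex_intro _ (Ordinal lt1) H1)).
by rewrite /psi_c (eqk : _ = _ :> nat).
Qed.

(* Main.v *)
Require Import Defs.
From mathcomp Require Import all_boot all_order all_algebra.
From mathcomp Require Import all_classical all_reals all_analysis.
From mathcomp Require Import all_field zify ring lra.

Import Order.TTheory GRing.Theory Num.Theory.
Import numFieldNormedType.Exports.
Set Implicit Arguments.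
Unset Strict Implicit.
Unset Printing Implicit Defensive.

Local Open Scope classical_set_scope.
Local Open Scope ring_scope.

(** A partial coloring of the edges of K_n in which every class is connected
    and every two classes share a vertex extends to all edges as soon as one
    vertex is left untouched ([double_star_packing]).  So it suffices to pack
    many pairwise edge-disjoint, pairwise touching connected subgraphs, and
    here all of them are double stars: one fixed edge is met by all the others.

    The packing ([field_packing]) is built on the affine plane F x F over a
    field with q elements, whose points are vertices. Each class contains all
    points of some line y = s x + c, so classes on lines of different slopes
    meet; one extra vertex per slope s, joined to every class of slope s, takes
    care of parallel lines. The points of a line are connected in two ways.
    Inside the line, the complete graph on q vertices splits into floor(q/2)
    spanning double stars. From outside the plane, an apex vertex labelled by a
    slope s is joined to all q^2 points, and these edges split into q stars, one
    for each line of slope s. With q * tau apexes this gives q^2 (tau +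
    floor(q/2)) classes on q^2 + q + q tau vertices.

    For given n one takes tau close to n/q - q.  The number of classes is then
    q n - q^3/2 - O(q^2), and with r the square root of n,
      2 q r^2 - q^3 - r^3 = (r - q) (q^2 + q r - r^2)
    is nonnegative whenever q <= r <= phi q, where phi = 1.618... is the golden
    ratio.  Hence an error term linear in n does not require q to be close to
    the square root of n: a prime power q in the wide window between 0.62 r
    and r is enough.  Chebyshev's method, applied to the ratios
    (6 n)! n! / ((3 n)! (2 n)!^2), provides one for all large n
    ([prime_power_between]): these ratios determine the growth of the function
    psi up to a factor arbitrarily close to 3/2, and 3/2 < 8/5 < phi.

    The remaining finitely many n are absorbed by the function h. *)

(** * From packings of double stars to colorings *)

Section DoubleStarPacking.
Local Open Scope nat_scope.
Local Open Scope set_scope.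

Lemma complete_edge n (x y : 'I_n) : x != y ->
  {e : line_graph (complete_graph n) | val e = [set x; y]}.
Proof.
move=> xy; suff exy : [set x; y] \in edges (complete_graph n).
  by exists (exist (fun e => e \in edges (complete_graph n)) _ exy).
by apply/imsetP; exists (x, y); rewrite ?inE.
Qed.

Lemma complete_edgeP n (e : line_graph (complete_graph n)) :
  exists x y, x != y /\ val e = [set x; y].
Proof. by have /imsetP[[x y] xy ->] := valP e; exists x, y; rewrite inE in xy. Qed.

(** The walks to [r] may pause, so that a walk through a list of edges of a
    line graph is allowed to repeat an edge. *)
Lemma color_class_connect k (H : sgraph) (c : {ffun H -> 'I_k}) i (r : H) :
  c r = i ->
  (forall x, c x = i -> exists p, [/\ path (fun y z => (y == z) || adj y z) x p,
     all (fun y => c y == i) p & last x p = r]) ->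
  connected_graph (Defs.induced (color_class c i)).
Proof.
move=> cr toroot.
have rA : r \in color_class c i by rewrite inE cr.
pose root : Defs.induced (color_class c i) := exist _ r rA.
have conn x : connect adj x root.
  case: x => x xi; have := xi; rewrite inE => /eqP /toroot[p []].
  elim: p x xi => [|y p IH] x xi /=.
    by move=> _ _ xr; apply/eq_connect0/val_inj.
  case/andP=> xy yp /andP[yi pi] yr.
  have yi' : y \in color_class c i by rewrite inE.
  apply: connect_trans (IH y yi' yp pi yr).
  case/orP: xy => [/eqP eq_xy|xy]; last exact: connect1.
  exact/eq_connect0/val_inj.
apply/andP; split; first by apply/card_gt0P; exists root.
apply/'forall_forallP => x y; apply: connect_trans (conn x) _.
by rewrite sym_connect_sym //; exact: adj_sym.
Qed.

Lemma line_meet n (e f : line_graph (complete_graph n)) v :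
  v \in val e -> v \in val f -> (e == f) || adj e f.
Proof.
move=> ve vf; rewrite /= /line_adj; case: (e == f) => //=.
by apply/set0Pn; exists v; rewrite inE ve.
Qed.

(** All edges not in the packing join one class [k0].  That class stays
    connected because of the vertex [ord_max] outside the image of [V]:
    its edges form a star that reaches every vertex and lies in the class
    [k0] entirely. *)
Lemma double_star_packing (V K : finType) n (E : K -> rel V) (a b : K -> V) :
  #|V| < n ->
  (forall k, symmetric (E k)) -> (forall k, irreflexive (E k)) ->
  (forall k k' u v, E k u v -> E k' u v -> k = k') ->
  (forall k, E k (a k) (b k)) ->
  (forall k u v, E k u v -> (u \in [:: a k; b k]) || (v \in [:: a k; b k])) ->
  (forall k k', exists w u u', E k u w /\ E k' u' w) ->
  #|K| <= psi'_c (complete_graph n).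
Proof.
move=> ltVn Esym Eirr Euniq Eab Estar Emeet.
case: (pickP (@predT K)) => [k0 _|K0]; last by rewrite eq_card0.
case: n ltVn => // n ltVn.
pose f (v : V) : 'I_n.+1 := widen_ord (ltnW ltVn) (enum_rank v).
have f_inj : injective f.
  by move=> u v /(congr1 val) /= /val_inj /enum_rank_inj.
have fmax v : f v != ord_max.
  by rewrite -val_eqE /= neq_ltn (leq_trans (ltn_ord _)).
pose L := line_graph (complete_graph n.+1).
pose pat (e : L) k := [exists u, exists v, E k u v && (val e == [set f u; f v])].
pose col (e : L) := odflt k0 [pick k | pat e k].
have pat_uniq e k k' : pat e k -> pat e k' -> k = k'.
  case/existsP=> u /existsP[v /andP[Euv /eqP eq_e]].
  case/existsP=> u' /existsP[v' /andP[Euv']]; rewrite eq_e => /eqP eq_uv.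
  have uv : u != v by apply: contraTneq Euv => ->; rewrite Eirr.
  have ui : f u \in [set f u'; f v'] by rewrite -eq_uv set21.
  have vi : f v \in [set f u'; f v'] by rewrite -eq_uv set22.
  move: ui vi; rewrite !inE !(inj_eq f_inj).
  case/orP=> /eqP eu /orP[]/eqP ev; subst; rewrite ?eqxx // in uv.
    exact: Euniq Euv Euv'.
  by apply: Euniq Euv _; rewrite Esym.
have col_pat e k : pat e k -> col e = k.
  move=> ek; rewrite /col; case: pickP => [k' ek'|/(_ k)]; last by rewrite ek.
  exact: pat_uniq ek' ek.
have patE k u v (e : L) : E k u v -> val e = [set f u; f v] -> pat e k.
  move=> Euv eq_e; apply/existsP; exists u; apply/existsP; exists v.
  by rewrite Euv eq_e eqxx.
have mk k u v : E k u v -> {e : L | val e = [set f u; f v] & pat e k}.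
  move=> Euv; have uv : f u != f v.
    by rewrite inj_eq //; apply: contraTneq Euv => ->; rewrite Eirr.
  by have [e eq_e] := complete_edge uv; exists e => //; exact: patE Euv eq_e.
have spare (e : L) : ord_max \in val e -> col e = k0.
  move=> maxe; rewrite /col; case: pickP => // k.
  case/existsP=> u /existsP[v /andP[_ /eqP eq_e]].
  by move: maxe; rewrite eq_e !inE !(eq_sym ord_max) !(negPf (fmax _)).
apply: psi_c_max; apply/existsP; exists [ffun e => enum_rank (col e)].
have rankK i (e : L) : ([ffun e => enum_rank (col e)] e == i) = (col e == enum_val i).
  by rewrite ffunE -(inj_eq enum_val_inj) enum_rankK.
apply/andP; split; apply/forallP => i.
  set k := enum_val i.
  have [r val_r rk] := mk _ _ _ (Eab k).
  apply: (@color_class_connect _ _ _ _ r).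
    by apply/eqP; rewrite rankK (col_pat _ _ rk).
  move=> e /eqP; rewrite rankK -/k => /eqP ek.
  have [|nopat] := boolP (pat e k).
    case/existsP=> u /existsP[v /andP[Euv /eqP val_e]].
    exists [:: r]; split=> //=; last by rewrite rankK (col_pat _ _ rk) eqxx.
    rewrite andbT; have := Estar _ _ _ Euv; rewrite !inE.
    by case/orP=> /orP[]/eqP eq_uv; [apply: (@line_meet _ _ _ (f u))
      | apply: (@line_meet _ _ _ (f u)) | apply: (@line_meet _ _ _ (f v))
      | apply: (@line_meet _ _ _ (f v))]; rewrite ?val_e ?val_r ?eq_uv ?set21 ?set22.
  (* [e] is outside the packing: walk along [e], two edges at [ord_max], [r] *)
  have k0k : k0 = k.
    move: ek nopat; rewrite /col; case: pickP => [k' ek' /= <-|_ /= ->] //.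
    by rewrite ek'.
  have [x [xe xmax]] : exists x, x \in val e /\ x != ord_max.
    have [x [y [xy eq_e]]] := complete_edgeP e.
    have [xm|] := eqVneq x ord_max; last by exists x; rewrite eq_e set21.
    by exists y; rewrite eq_e set22 -xm eq_sym.
  have [e1 eq_e1] := complete_edge xmax.
  have [e2 eq_e2] := complete_edge (fmax (a k)).
  exists [:: e1; e2; r]; split=> //=.
    apply/and4P; split=> //; [apply: line_meet xe _ | apply: (@line_meet _ _ _ ord_max)
      | apply: (@line_meet _ _ _ (f (a k)))];
    by rewrite ?val_r ?eq_e1 ?eq_e2 ?set21 ?set22.
  by rewrite !rankK (col_pat _ _ rk) -/k -k0k !spare ?eqxx // ?eq_e1 ?eq_e2 set22.
apply/forallP => j; apply/implyP => ij.
have [w [u [u' [Euw Euw']]]] := Emeet (enum_val i) (enum_val j).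
have [e val_e ei] := mk _ _ _ Euw; have [e' val_e' ej] := mk _ _ _ Euw'.
apply/exists_inP; exists e; first by rewrite inE rankK (col_pat _ _ ei).
apply/exists_inP; exists e'; first by rewrite inE rankK (col_pat _ _ ej).
have: (e == e') || adj e e'.
  by apply: (@line_meet _ _ _ (f w)); rewrite ?val_e ?val_e' set22.
case: eqP => //= ee; subst e'.
by move: ij; rewrite -(inj_eq enum_val_inj) (pat_uniq _ _ _ ei ej) eqxx.
Qed.

End DoubleStarPacking.

(** * Splitting a complete graph into double stars *)

Section DoubleStars.
Local Open Scope nat_scope.

(** Write the vertices of the complete graph on 2 h vertices as pairs (a, e)
    with a < h and e < 2, coded by a + e h.  For a < b, the four edges between
    the pairs over a and over b are two perfect matchings; the one preserving e
    goes to the star of a, where it reaches both vertices over b, and the other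
    one goes to the star of b, where it reaches both vertices over a.  Together
    with the edge over i, the star of i is a spanning double star.  The same
    formula works with one vertex more, 2 h, which is coded by (0, 2). *)
Definition double_star_color (h j k : nat) : nat :=
  if j %% h == k %% h then j %% h
  else if j %/ h == k %/ h then minn (j %% h) (k %% h)
  else maxn (j %% h) (k %% h).

Lemma double_star_colorC h j k : double_star_color h j k = double_star_color h k j.
Proof.
rewrite /double_star_color eq_sym [k %/ h == _]eq_sym minnC maxnC.
by case: eqP => // ->.
Qed.

Lemma double_star_color_lt h j k : 0 < h -> double_star_color h j k < h.
Proof.
move=> h0; have ltj := ltn_pmod j h0; have ltk := ltn_pmod k h0.
by rewrite /double_star_color; do 2?case: ifP => // _; rewrite ?gtn_max ?gtn_min ltj ?ltk.
Qed.

Lemma double_star_center h i : i < h -> double_star_color h i (i + h) = i.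
Proof. by move=> ih; rewrite /double_star_color modnDr modn_small // eqxx. Qed.

Lemma double_star_meet h j k i : 0 < h -> j <= h.*2 -> k <= h.*2 -> j != k ->
  double_star_color h j k = i -> (j \in [:: i; i + h]) || (k \in [:: i; i + h]).
Proof.
move=> h0 j2h k2h jk; rewrite /double_star_color.
have := divn_eq j h; have := divn_eq k h.
have := ltn_pmod j h0; have := ltn_pmod k h0.
move: (j %/ h) (j %% h) (k %/ h) (k %% h) => e a e' a' ltka ltja ek ej.
rewrite !inE.
have e3 : e < 3 by rewrite ltnNge; apply/negP => le3e; nia.
have e3' : e' < 3 by rewrite ltnNge; apply/negP => le3e; nia.
case: e e' e3 e3' ek ej => [|[|[|//]]] [|[|[|//]]] _ _ ek ej /=;
  by case: (a =P a') => ? <-; lia.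
Qed.

(** The neighbor lies among the centers, hence below 2 h even when the complete
    graph has the additional vertex 2 h. *)
Lemma double_star_cover h i j : i < h -> j <= h.*2 ->
  exists k, [/\ k < h.*2, k != j & double_star_color h j k = i].
Proof.
move=> ih j2h; have h0 : 0 < h by lia.
have := divn_eq j h; have := ltn_pmod j h0.
rewrite /double_star_color.
move: (j %/ h) (j %% h) => e a ltah ej.
have e3 : e < 3 by rewrite ltnNge; apply/negP => le3e; nia.
have mod1 : (i + h) %% h = i by rewrite modnDr modn_small.
have div1 : (i + h) %/ h = 1 by rewrite divnDr ?dvdnn // divn_small // divnn h0.
have mod0 : i %% h = i by rewrite modn_small.
have div0 : i %/ h = 0 by rewrite divn_small.
have [ai|ai] := eqVneq a i.
  by case: (eqVneq e 0) => e0; [exists (i + h) | exists i];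
    rewrite ?mod0 ?mod1 ?ai ?eqxx; split=> //; subst; try (apply/eqP); nia.
have [lt_ai|le_ia] := ltnP a i.
  case: (eqVneq e 0) => e0; [exists (i + h) | exists i];
    rewrite ?mod0 ?mod1 ?div0 ?div1 (negPf ai) ?(negPf e0) ?e0 /=;
  split=> //; try (apply/eqP); nia.
case: (eqVneq e 0) => e0; [exists i | exists (i + h)];
  rewrite ?mod0 ?mod1 ?div0 ?div1 (negPf ai) ?(negPf e0) ?e0 /=;
  split=> //; try (apply/eqP); try nia.
have -> : e == 1 by nia.
by lia.
Qed.

End DoubleStars.

(** * The packing over a finite field *)

Section FieldPacking.
Variables (F : finFieldType) (tau : nat).

Local Notation h := #|F|./2.
(* points of the plane, one vertex per slope, and the apexes *)
Let V : Type := (F * F + F + F * 'I_tau)%type.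
(* slope, apex index and intercept; or slope, intercept and double star *)
Let K : Type := (F * 'I_tau * F + F * F * 'I_h)%type.

Let pt (x y : F) : V := inl (inl (x, y)).
Let dir (s : F) : V := inl (inr s).
Let apex (s : F) (t : 'I_tau) : V := inr (s, t).

Let idx (x : F) : nat := index x (enum F).
Let el (j : nat) : F := nth 0 (enum F) j.

Let star_class (s : F) (t : 'I_tau) (c : F) : K := inl (s, t, c).
Let tree_class (s c : F) (i : nat) : option K :=
  omap (fun i => inr (s, c, i)) (insub i).

(** Two points get the same color in both orders, and of any other pair of
    vertices at most one order is colored, so this describes disjoint sets of
    edges.  The class of the line y = s x + c at the apex (s, t)
    reaches the vertex of slope s through a second apex (c, t + 1), where t + 1
    is cyclic modulo [tau].  The intercept c is recorded in this apex, so
    that its edge to the slope s determines the class. *)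
Definition partial_color (u v : V) : option K :=
  match u, v with
  | inr (s, t), inl (inl (x, y)) => Some (star_class s t (y - s * x))
  | inr (c, t), inl (inr s) => Some (star_class s (ord_pred t) c)
  | inr (s, t), inr (c, t') =>
      if t' == ordS t then Some (star_class s t c) else None
  | inl (inl (x, y)), inl (inr s) => tree_class s (y - s * x) (idx x)
  | inl (inl (x, y)), inl (inl (x', y')) =>
      if x == x' then None else
      let s := (y - y') / (x - x') in
      tree_class s (y - s * x) (double_star_color h (idx x) (idx x'))
  | _, _ => None
  end.

Definition colored (k : K) (u v : V) : bool :=
  (partial_color u v == Some k) || (partial_color v u == Some k).

Definition center1 (k : K) : V :=
  match k with
  | inl (s, t, c) => apex s t
  | inr (s, c, i) => pt (el i) (s * el i + c)
  end.

Definition center2 (k : K) : V :=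
  match k with
  | inl (s, t, c) => apex c (ordS t)
  | inr (s, c, i) => pt (el (i + h)%N) (s * el (i + h)%N + c)
  end.

Let ltidx x : (idx x < #|F|)%N.
Proof. by rewrite cardE index_mem mem_enum. Qed.

Let idxK : cancel idx el.
Proof. by move=> x; rewrite /el /idx nth_index ?mem_enum. Qed.

Let elK j : (j < #|F|)%N -> idx (el j) = j.
Proof. by move=> ltj; rewrite /idx /el index_uniq ?enum_uniq // -cardE. Qed.

Let h_gt0 : (0 < h)%N.
Proof. by rewrite half_gt0 finNzRing_gt1. Qed.

Let card_le : (h.*2 <= #|F| <= h.*2.+1)%N.
Proof. by rewrite -{2 3}(odd_double_half #|F|); case: odd; rewrite ?leqnn ?leqnSn. Qed.


Let half_leq_card : (h <= #|F|)%N.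
Proof. by have := card_le; lia. Qed.

Let tree_classE s c i k : tree_class s c i = Some k ->
  exists2 j : 'I_h, j = i :> nat & k = inr (s, c, j).
Proof. by rewrite /tree_class; case: insubP => //= j _ eq_j [<-]; exists j. Qed.

Let tree_class_ord s c (i : 'I_h) : tree_class s c i = Some (inr (s, c, i)).
Proof. by rewrite /tree_class valK. Qed.

Let partial_color_line s c x x' : x != x' ->
  partial_color (pt x (s * x + c)) (pt x' (s * x' + c)) =
  tree_class s c (double_star_color h (idx x) (idx x')).
Proof.
move=> xx' /=; rewrite (negPf xx').
have -> : (s * x + c - (s * x' + c)) / (x - x') = s.
  by rewrite opprD addrACA subrr addr0 -mulrBr mulfK // subr_eq0.
by rewrite [s * x + c]addrC addrK.
Qed.

Let partial_color_pts x y x' y' k :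
  partial_color (pt x y) (pt x' y') = Some k ->
  exists s c (i : 'I_h), [/\ x != x', y = s * x + c, y' = s * x' + c,
    i = double_star_color h (idx x) (idx x') :> nat & k = inr (s, c, i)].
Proof.
move=> /=; have [//|xx'] := eqVneq x x'.
case/tree_classE=> i eq_i ->; exists ((y - y') / (x - x')); eexists; exists i; split=> //.
  by rewrite addrC subrK.
have xx0 : x - x' != 0 by rewrite subr_eq0.
by apply/eqP; rewrite -subr_eq0; apply/eqP; field.
Qed.

(* between apexes, t' = t + 1 and t = t' + 1 exclude each other modulo tau > 2 *)
Let partial_colorC u v k k' : (2 < tau)%N ->
  partial_color u v = Some k -> partial_color v u = Some k' -> k = k'.
Proof.
move=> tau2; case: u v => [[[x y]|s]|[s t]] [[[x' y']|s']|[s' t']] //.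
  move=> /partial_color_pts[s [c [i [xx' -> -> eq_i ->]]]].
  rewrite partial_color_line 1?eq_sym // double_star_colorC -eq_i tree_class_ord.
  by case.
move=> /=; case: eqP => // t't _; case: eqP => // tt'.
have := congr1 (@nat_of_ord tau) tt'; have := congr1 (@nat_of_ord tau) t't.
have := ltn_ord t; have := ltn_ord t'; rewrite /= => ltb lta eqb eqa; exfalso.
move: (nat_of_ord t) (nat_of_ord t') ltb lta eqb eqa => a b ltb lta eqb eqa.
have : (a = (a.+2) %% tau)%N.
  by rewrite [LHS]eqa eqb -[in LHS]addn1 modnDml addn1.
have [lt2|ge2] := ltnP a.+2 tau; first by rewrite modn_small //; lia.
rewrite -(subnK ge2) modnDr modn_small; lia.
Qed.

Lemma colored_sym k : symmetric (colored k).
Proof. by move=> u v; rewrite /colored orbC. Qed.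

Lemma colored_irrefl k : (2 < tau)%N -> irreflexive (colored k).
Proof.
move=> tau2 u; rewrite /colored orbb; case: u => [[[x y]|s]|[s t]] //=.
  by rewrite eqxx.
case: (t =P ordS t) => //= /(congr1 (@nat_of_ord tau)) /= tt; have := ltn_ord t.
move: tt; move: (nat_of_ord t) => a eqa lta; exfalso.
have [lt1|ge1] := ltnP a.+1 tau; first by move: eqa; rewrite modn_small //; lia.
have aE : a.+1 = tau by lia.
by move: eqa; rewrite aE modnn; lia.
Qed.

Lemma colored_uniq k k' u v : (2 < tau)%N ->
  colored k u v -> colored k' u v -> k = k'.
Proof.
move=> tau2 /orP[]/eqP c1 /orP[]/eqP c2.
- by move: c1; rewrite c2 => -[].
- exact: partial_colorC c1 c2.
- exact: partial_colorC c1 c2.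
- by move: c1; rewrite c2 => -[].
Qed.

Lemma colored_centers k : colored k (center1 k) (center2 k).
Proof.
apply/orP; left; apply/eqP; case: k => [[[s t] c]|[[s c] i]].
  by rewrite /= eqxx.
rewrite /center1 /center2; have lti := ltn_ord i.
have lt1 : (i < #|F|)%N by have := card_le; lia.
have lt2 : (i + h < #|F|)%N by have := card_le; lia.
rewrite partial_color_line ?elK //.
  by rewrite double_star_center // tree_class_ord.
by apply/eqP => /(congr1 idx); rewrite !elK //; lia.
Qed.

Lemma colored_meets_center k u v : colored k u v ->
  (u \in [:: center1 k; center2 k]) || (v \in [:: center1 k; center2 k]).
Proof.
suff H u' v' : partial_color u' v' = Some k ->
  (u' \in [:: center1 k; center2 k]) || (v' \in [:: center1 k; center2 k]).
  by case/orP=> /eqP; [|rewrite orbC]; exact: H.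
case: u' v' => [[[x y]|s]|[s t]] [[[x' y']|s']|[s' t']] //.
- move=> /partial_color_pts[s [c [i [xx' -> -> eq_i ->]]]].
  have ltF z : (idx z <= h.*2)%N by have := ltidx z; have := card_le; lia.
  have neq_idx : idx x != idx x' by rewrite (can_eq idxK).
  have := double_star_meet h_gt0 (ltF x) (ltF x') neq_idx (esym eq_i).
  by rewrite !inE => /orP[]/orP[]/eqP e; rewrite /center1 /center2 -e idxK eqxx ?orbT.
- move=> /tree_classE[i eq_i ->].
  by rewrite !inE /= eq_i idxK addrC subrK eqxx.
- by case=> <-; rewrite inE eqxx.
- by case=> <-; rewrite !inE /= ord_predK eqxx ?orbT.
- by move=> /=; case: eqP => // _ [<-]; rewrite inE eqxx.
Qed.

(* slope and intercept of the line carrying a class *)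
Let line (k : K) : F * F :=
  match k with inl (s, t, c) => (s, c) | inr (s, c, i) => (s, c) end.

Lemma colored_line k x :
  exists u, colored k u (pt x ((line k).1 * x + (line k).2)).
Proof.
case: k => [[[s t] c]|[[s c] i]] /=.
  by exists (apex s t); rewrite /colored /= addrC addKr eqxx.
have ltF z : (idx z <= h.*2)%N by have := ltidx z; have := card_le; lia.
have [j [ltj neq_j eq_i]] := double_star_cover (ltn_ord i) (ltF x).
have ltjF : (j < #|F|)%N by have := card_le; lia.
exists (pt (el j) (s * el j + c)); apply/orP; left; apply/eqP.
rewrite partial_color_line ?elK //; last by rewrite -(can_eq idxK) elK.
by rewrite double_star_colorC eq_i tree_class_ord.
Qed.

Lemma colored_direction k : exists u, colored k u (dir (line k).1).
Proof.
case: k => [[[s t] c]|[[s c] i]] /=.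
  by exists (apex c (ordS t)); rewrite /colored /= ordSK eqxx.
exists (pt (el i) (s * el i + c)); rewrite /colored /= addrC addKr elK ?tree_class_ord ?eqxx //.
exact: leq_trans (ltn_ord i) half_leq_card.
Qed.

Lemma colored_common_vertex k k' :
  exists w u u', colored k u w /\ colored k' u' w.
Proof.
have [ss|ss] := eqVneq (line k).1 (line k').1.
  have [u uk] := colored_direction k; have [u' uk'] := colored_direction k'.
  by exists (dir (line k).1), u, u'; rewrite {2}ss.
pose x := ((line k').2 - (line k).2) / ((line k).1 - (line k').1).
have [u uk] := colored_line k x; have [u' uk'] := colored_line k' x.
exists (pt x ((line k).1 * x + (line k).2)), u, u'; split=> //.
suff -> : (line k).1 * x + (line k).2 = (line k').1 * x + (line k').2 by [].
have ss0 : (line k).1 - (line k').1 != 0 by rewrite subr_eq0.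
by rewrite /x; field.
Qed.

Theorem field_packing n : (2 < tau)%N ->
  (#|F| ^ 2 + #|F| + #|F| * tau < n)%N ->
  (#|F| ^ 2 * (tau + h) <= psi'_c (complete_graph n))%N.
Proof.
move=> tau2 ltn.
have -> : (#|F| ^ 2 * (tau + h))%N = #|{: K}|.
  by rewrite card_sum !card_prod !card_ord mulnDr mulnAC.
apply: (@double_star_packing V _ _ colored center1 center2).
- by rewrite !card_sum !card_prod !card_ord.
- exact: colored_sym.
- by move=> k; exact: colored_irrefl.
- by move=> k k' u v; exact: colored_uniq.
- exact: colored_centers.
- exact: colored_meets_center.
- exact: colored_common_vertex.
Qed.

End FieldPacking.

(** * Prime powers in short intervals *)

Section Chebyshev.
Local Open Scope nat_scope.

(** The product of exp(Lambda(d) f(d)) over all d, with Lambda the von Mangoldt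
    function.  The cutoff [R] only makes the product finite: it is harmless as
    soon as f vanishes above [R] ([ppow_prod_widen]). *)
Definition ppow_prod (R : nat) (f : nat -> nat) : nat :=
  \prod_(0 <= p < R.+1 | prime p) \prod_(1 <= k < R.+1) p ^ f (p ^ k).

(** exp(psi(N)) for the Chebyshev function psi, in other words the least
    common multiple of 1, ..., N. *)
Definition psi_prod (N : nat) : nat := ppow_prod N (fun d => d <= N).

Lemma ppow_prodD R f g :
  ppow_prod R (fun d => f d + g d) = ppow_prod R f * ppow_prod R g.
Proof.
rewrite /ppow_prod -big_split; apply: eq_bigr => p _ /=.
by rewrite -big_split; apply: eq_bigr => k _; rewrite expnD.
Qed.

Lemma leq_ppow_prod R f g : (forall d, 0 < d -> f d <= g d) ->
  ppow_prod R f <= ppow_prod R g.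
Proof.
move=> le_fg; apply: leq_prod => p p_prime; apply: leq_prod => k _.
by rewrite leq_pexp2l ?prime_gt0 // le_fg // expn_gt0 prime_gt0.
Qed.

Lemma ppow_prod_widen N R f : N <= R -> (forall d, N < d -> f d = 0) ->
  ppow_prod R f = ppow_prod N f.
Proof.
move=> leNR f0; rewrite /ppow_prod (big_cat_nat (n := N.+1)) //=.
rewrite [X in _ * X]big1_seq ?muln1 => [|p /andP[p_prime]].
  apply: eq_bigr => p p_prime; rewrite (big_cat_nat (n := N.+1)) //=.
  rewrite [X in _ * X]big1_seq ?muln1 => // k.
  rewrite mem_index_iota => /andP[_ /andP[ltNk _]].
  by rewrite f0 // (leq_trans ltNk) // ltnW // ltn_expl // prime_gt1.
rewrite mem_index_iota => /andP[ltNp _]; rewrite big1_seq // => k.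
rewrite mem_index_iota => /andP[_ /andP[k0 _]]; rewrite f0 // (leq_trans ltNp) //.
by case: k k0 => // k _; rewrite expnS leq_pmulr // expn_gt0 prime_gt0.
Qed.

Lemma prod_primes_le n R : 0 < n -> (forall p, prime p -> p %| n -> p <= R) ->
  n = \prod_(0 <= p < R.+1 | prime p) p ^ logn p n.
Proof.
move=> n0 leR; rewrite -{1}(partnT n0) (widen_partn _ (leq_maxl n R)).
rewrite (big_cat_nat (n := R.+1)) //=; last by rewrite ltnS leq_maxr.
rewrite [X in _ * X]big1_seq ?muln1 => [|p]; last first.
  rewrite mem_index_iota => /andP[_ /andP[ltRp _]].
  rewrite lognE; case: and3P => // -[p_prime _ /(leR _ p_prime)].
  by rewrite leqNgt ltRp.
rewrite [RHS]big_mkcond /=; apply: eq_bigr => p _.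
by case: ifP => // p_prime; rewrite lognE p_prime.
Qed.

(** Legendre's formula for all primes at once. *)
Lemma fact_ppow_prod N R : N <= R -> N`! = ppow_prod R (fun d => N %/ d).
Proof.
move=> leNR; rewrite (ppow_prod_widen leNR); last first.
  by move=> d; exact: divn_small.
rewrite {1}(@prod_primes_le N`! N) ?fact_gt0 //.
  by apply: eq_bigr => p p_prime; rewrite logn_fact // expn_sum.
move=> p p_prime; elim: N {leNR} => [|n IH].
  by rewrite fact0 dvdn1 => /eqP p1; rewrite p1 in p_prime.
rewrite factS Euclid_dvdM // => /orP[/dvdn_leq -> //|/IH/leq_trans -> //].
Qed.

Lemma psi_prodE N R : N <= R -> psi_prod N = ppow_prod R (fun d => d <= N).
Proof.
by move=> leNR; rewrite (ppow_prod_widen leNR) // => d; rewrite ltnNge => /negPf ->.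
Qed.

Lemma psi_prod_gt0 N : 0 < psi_prod N.
Proof.
by apply: prodn_cond_gt0 => p p_prime; apply: prodn_gt0 => k; rewrite expn_gt0 prime_gt0.
Qed.

Lemma leq_psi_prod : {homo psi_prod : M N / M <= N}.
Proof.
move=> M N leMN; rewrite (psi_prodE leMN); apply: leq_ppow_prod => d _.
by case: (leqP d M) => // ledM; rewrite (leq_trans ledM leMN).
Qed.

(** As a function of n/d, the difference of the two sums of integer parts has
    period 1 and takes the values 0 and 1 only; it is 0 for n/d below 1/6 and
    1 for n/d in [1/6, 1/2). *)
Lemma chebyshev_floor n d : 0 < d ->
  let lhs := 6 * n %/ d + n %/ d in
  let rhs := 3 * n %/ d + (2 * n %/ d + 2 * n %/ d) in
  lhs <= rhs + (d <= 6 * n) /\ rhs + (d <= 6 * n) <= lhs + (d <= 2 * n).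
Proof.
move=> d0 /=; have r_lt := ltn_pmod n d0; have := divn_eq n d.
move: (n %/ d) (n %% d) r_lt => a r r_lt nE.
have E m : m * n %/ d = m * a + (m * r) %/ d.
  by rewrite nE mulnDr mulnA divnMDl.
rewrite !E; have := divn_eq (6 * r) d; have := divn_eq (3 * r) d.
have := divn_eq (2 * r) d; have := ltn_pmod (6 * r) d0.
have := ltn_pmod (3 * r) d0; have := ltn_pmod (2 * r) d0.
move: (6 * r %/ d) (3 * r %/ d) (2 * r %/ d) => s6 s3 s2.
move: (6 * r %% d) (3 * r %% d) (2 * r %% d) => r6 r3 r2 l2 l3 l6 e2 e3 e6.
have s6lt : s6 < 6 by rewrite ltnNge; apply/negP => ?; nia.
have s3lt : s3 < 3 by rewrite ltnNge; apply/negP => ?; nia.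
have s2lt : s2 < 2 by rewrite ltnNge; apply/negP => ?; nia.
have [a0|a_gt0] := posnP a.
  rewrite a0 mul0n add0n in nE; rewrite a0 nE.
  by case: s6 s6lt e6 => [|[|[|[|[|[|//]]]]]] _ e6;
     case: s3 s3lt e3 => [|[|[|//]]] _ e3;
     case: s2 s2lt e2 => [|[|//]] _ e2; lia.
have ledn : d <= n by nia.
have -> : d <= 6 * n by lia.
have -> : d <= 2 * n by lia.
by case: s6 s6lt e6 => [|[|[|[|[|[|//]]]]]] _ e6;
   case: s3 s3lt e3 => [|[|[|//]]] _ e3;
   case: s2 s2lt e2 => [|[|//]] _ e2; lia.
Qed.

(* numerator and denominator of Chebyshev's ratio, which grows like 108 ^ n *)
Let num n := (6 * n)`! * n`!.
Let den n := (3 * n)`! * ((2 * n)`! * (2 * n)`!).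

Let den_gt0 n : 0 < den n.
Proof. by rewrite !muln_gt0 !fact_gt0. Qed.

Let num_ppow n : num n = ppow_prod (6 * n) (fun d => 6 * n %/ d + n %/ d).
Proof.
rewrite ppow_prodD -!fact_ppow_prod //; lia.
Qed.

Let den_ppow n :
  den n = ppow_prod (6 * n) (fun d => 3 * n %/ d + (2 * n %/ d + 2 * n %/ d)).
Proof.
rewrite !ppow_prodD -!fact_ppow_prod //; lia.
Qed.

Lemma fact_ratio_le_psi n : num n <= den n * psi_prod (6 * n).
Proof.
rewrite num_ppow den_ppow /psi_prod -ppow_prodD; apply: leq_ppow_prod => d d0.
by case: (chebyshev_floor n d0).
Qed.

Lemma psi_le_fact_ratio n : den n * psi_prod (6 * n) <= num n * psi_prod (2 * n).
Proof.
rewrite num_ppow den_ppow (@psi_prodE (2 * n) (6 * n)); last by lia.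
rewrite /psi_prod -!ppow_prodD; apply: leq_ppow_prod => d d0.
by case: (chebyshev_floor n d0).
Qed.

Let num_den_S n : exists c,
  [/\ num n.+1 = num n * (72 * c * ((6 * n + 1) * (6 * n + 5)))
    & den n.+1 = den n * (12 * c * ((n + 1) * (2 * n + 1)))].
Proof.
exists ((n + 1) ^ 2 * (3 * n + 1) * (3 * n + 2) * (2 * n + 1)).
have e6 : 6 * n.+1 = (6 * n).+4.+2 by lia.
have e3 : 3 * n.+1 = (3 * n).+3 by lia.
have e2 : 2 * n.+1 = (2 * n).+2 by lia.
rewrite /num /den e6 e3 e2 !factS.
move: ((6 * n)`!) ((3 * n)`!) ((2 * n)`!) (n`!) => f6 f3 f2 f1.
by split; ring.
Qed.

Lemma fact_ratio_upper n : num n <= 108 ^ n * den n.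
Proof.
elim: n => [//|n IH]; have [c [-> ->]] := num_den_S n.
have le_q : 72 * ((6 * n + 1) * (6 * n + 5)) <= 108 * (12 * ((n + 1) * (2 * n + 1))).
  by nia.
have -> A : num n * (72 * c * A) = num n * (c * (72 * A)) by ring.
have -> B : 108 ^ n.+1 * (den n * (12 * c * B)) = 108 ^ n * den n * (c * (108 * (12 * B))).
  by rewrite expnS; ring.
by rewrite leq_mul // leq_mul.
Qed.

Lemma fact_ratio_lower n : 0 < n -> 108 ^ n * den n <= 4 * n * num n.
Proof.
case: n => // n _; elim: n => [|n IH].
  by rewrite /num /den !factS fact0.
have [c [-> ->]] := num_den_S n.+1; move: n.+1 IH => m IH.
have le_q : m * (108 * (12 * ((m + 1) * (2 * m + 1)))) <=
    m.+1 * (72 * ((6 * m + 1) * (6 * m + 5))) by nia.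
have -> A : 4 * m.+1 * (num m * (72 * c * A)) = 4 * num m * (c * (m.+1 * (72 * A))) by ring.
have eqB B : 108 ^ m.+1 * (den m * (12 * c * B)) = 108 ^ m * den m * (c * (108 * (12 * B))).
  by rewrite expnS; ring.
rewrite eqB; apply: leq_trans (leq_mul IH (leqnn _)) _.
have -> B : 4 * m * num m * (c * (108 * (12 * B))) = 4 * num m * (c * (m * (108 * (12 * B)))).
  by ring.
by rewrite leq_mul // leq_mul.
Qed.

Lemma psi_prod_step n : psi_prod (6 * n) <= 108 ^ n * psi_prod (2 * n).
Proof.
rewrite -(leq_pmul2l (den_gt0 n)); apply: leq_trans (psi_le_fact_ratio n) _.
by rewrite mulnCA mulnA leq_mul // fact_ratio_upper.
Qed.

Lemma psi_prod_lower n : 0 < n -> 108 ^ n <= 4 * n * psi_prod (6 * n).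
Proof.
move=> n0; rewrite -(leq_pmul2r (den_gt0 n)); apply: leq_trans (fact_ratio_lower n0) _.
by rewrite -[4 * n * _ * _]mulnA leq_mul // mulnC fact_ratio_le_psi.
Qed.

(** Iterating [psi_prod_step] along N, N/3, N/9, ... bounds psi(N) by
    (1/4 + o(1)) N log 108.  The rational 5/19 = 0.263... leaves room for the
    rounding in each step, and is still below 8/5 * 1/6 = 0.266..., where 1/6
    is the constant of [psi_prod_lower] and 8/5 the length of the interval in
    which a prime power is sought. *)
Lemma psi_prod_upper : exists C, forall N, psi_prod N ^ 19 <= 108 ^ (5 * N + C).
Proof.
(* from 174 on, 29 (N / 6 + 1) <= 5 N absorbs the rounding of N / 6 *)
exists (psi_prod 174 * 19) => N; elim/ltn_ind: N => N IH.
have [le174|lt174] := leqP N 174.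
  apply: leq_trans (_ : (2 ^ psi_prod 174) ^ 19 <= _).
    by rewrite leq_exp2r // (leq_trans (leq_psi_prod le174)) // ltnW // ltn_expl.
  rewrite -expnM; apply: leq_trans (_ : 108 ^ (psi_prod 174 * 19) <= _).
    by rewrite leq_exp2r // muln_gt0 psi_prod_gt0.
  by rewrite leq_pexp2l // leq_addl.
have Ndiv := divn_eq N 6; have Nmod : N %% 6 < 6 by rewrite ltn_pmod.
move: (N %/ 6) (N %% 6) Ndiv Nmod => m r NE r6.
have le6 : N <= 6 * m.+1 by lia.
apply: leq_trans (_ : (108 ^ m.+1 * psi_prod (2 * m.+1)) ^ 19 <= _).
  by rewrite leq_exp2r // (leq_trans (leq_psi_prod le6)) // psi_prod_step.
rewrite expnMn -expnM.
apply: leq_trans (leq_mul (leqnn _) (IH (2 * m.+1) _)) _; first by lia.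
by rewrite -expnD leq_pexp2l //; lia.
Qed.

Lemma psi_prod_no_ppow x M : x <= M ->
  (forall p k, prime p -> 0 < k -> ~~ (x < p ^ k <= M)) -> psi_prod M = psi_prod x.
Proof.
move=> lexM nopp; rewrite (psi_prodE lexM) /psi_prod.
apply: eq_bigr => p p_prime; apply: eq_big_seq => k.
rewrite mem_index_iota => /andP[k0 _]; have := nopp p k p_prime k0.
by case: (leqP (p ^ k) x) => [lex _|_ /= /negPf ->] //; rewrite (leq_trans lex lexM).
Qed.

Lemma poly_lt_exp C : exists y0, forall y, y0 <= y ->
  (32 * y) ^ 19 * 108 ^ C < 108 ^ (2 * y).
Proof.
exists (2 * (2 * C + 30)) => y ley; pose j := y./2.
have yj : y < 2 * 2 ^ j.
  by have := ltn_expl j (isT : 1 < 2); have := odd_double_half y; rewrite -/j; lia.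
have lej : 2 * C + 30 <= j by have := odd_double_half y; rewrite -/j; lia.
apply: leq_ltn_trans (_ : (2 ^ (j + 6)) ^ 19 * (2 ^ 7) ^ C < _).
  rewrite leq_mul //; first by rewrite leq_exp2r // expnD; lia.
  by case: (C) => // c; rewrite leq_exp2r.
rewrite -!expnM -expnD; apply: leq_trans (_ : 2 ^ (6 * (4 * j)) <= _).
  by rewrite ltn_exp2l //; lia.
rewrite expnM; apply: leq_trans (_ : 108 ^ (4 * j) <= _).
  by rewrite leq_exp2r // ; lia.
by rewrite leq_pexp2l //; have := odd_double_half y; rewrite -/j; lia.
Qed.

(** Without a prime power in the interval psi(48 y) and psi(30 y) would agree,
    but the lower bound for the former exceeds the upper bound for the latter:
    8 * 19 = 152 > 150 = 5 * 30. *)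
Theorem prime_power_between : exists y0, forall y, y0 <= y ->
  exists p k, [/\ prime p, 0 < k & 30 * y < p ^ k <= 48 * y].
Proof.
have [C upper] := psi_prod_upper; have [y0 lty0] := poly_lt_exp C.
exists y0.+1 => y ley.
have [//|nopp] := boolp.pselect
  (exists p k, [/\ prime p, 0 < k & 30 * y < p ^ k <= 48 * y]).
have same : psi_prod (48 * y) = psi_prod (30 * y).
  apply: psi_prod_no_ppow => [|p k p_prime k0]; first by lia.
  by apply/negP => pk; apply: nopp; exists p, k.
have y_gt0 : 0 < 8 * y by lia.
have := psi_prod_lower y_gt0.
have -> : 6 * (8 * y) = 48 * y by lia.
rewrite same => le1.
have := lty0 y (ltnW ley); rewrite ltnNge => /negP[].
have le2 : 108 ^ (152 * y) <= (32 * y) ^ 19 * 108 ^ (150 * y + C).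
  apply: leq_trans (_ : (4 * (8 * y) * psi_prod (30 * y)) ^ 19 <= _).
    have -> : 152 * y = 8 * y * 19 by lia.
    by rewrite expnM leq_exp2r.
  rewrite expnMn mulnA leq_mul //.
  by apply: leq_trans (upper _) _; rewrite mulnA.
rewrite -(leq_pmul2l (_ : 0 < 108 ^ (150 * y))) ?expn_gt0 //.
rewrite -expnD mulnCA -expnD.
by have -> : 150 * y + 2 * y = 152 * y by lia.
Qed.

End Chebyshev.

(** * Choosing the field for a given n *)

Section Assembly.
Local Open Scope nat_scope.

Lemma floor_sqrt n : exists m, m ^ 2 <= n < m.+1 ^ 2.
Proof.
elim: n => [|n [m /andP[le_mn lt_nm]]]; first by exists 0.
have [lt|ge] := ltnP n.+1 (m.+1 ^ 2); first by exists m; rewrite lt (leq_trans le_mn).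
by exists m.+1; rewrite ge /=; nia.
Qed.

(** Let m be the integer part of the square root of n, and y that of
    (m - 10) / 48.  A prime power between 30 y and 48 y is at least 5/8 m up to
    a constant, hence more than 0.62 times the square root of n, and it is at
    most m - 10, which leaves room for three apexes per slope. *)
Lemma psi'_c_prime_power : exists N, forall n, N <= n -> exists q,
  [/\ q ^ 2 <= n, 62 ^ 2 * n <= (100 * q) ^ 2
    & 2 * (q * n) <= 2 * psi'_c (complete_graph n) + q ^ 3 + 5 * q ^ 2].
Proof.
have [y0 pp] := prime_power_between; exists ((48 * y0 + 100 * 100) ^ 2) => n len.
have [m /andP[le_mn lt_nm]] := floor_sqrt n.
have lem : 48 * y0 + 100 * 100 <= m.
  by rewrite -ltnS -ltn_sqr (leq_ltn_trans len).
have mE := divn_eq (m - 10) 48; have r48 : (m - 10) %% 48 < 48 by rewrite ltn_pmod.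
move: ((m - 10) %/ 48) ((m - 10) %% 48) mE r48 => y r mE r48.
have [|p [k [p_prime k0 /andP[lt_yq le_qy]]]] := pp y; first by lia.
have [F _ cardF] := pPrimePowerField p_prime k0.
move: (p ^ k) lt_yq le_qy cardF => q lt_yq le_qy cardF.
have leqm : q + 10 <= m by lia.
have lemq : 62 * m.+1 <= 100 * q by lia.
have q0 : 0 < q by lia.
have q2 : q ^ 2 + 20 * q <= n.
  by apply: leq_trans le_mn; nia.
exists q; split; first by lia.
  apply: leq_trans (_ : (62 * m.+1) ^ 2 <= _); last by rewrite leq_sqr.
  by rewrite expnMn leq_mul // ltnW.
clear -q0 q2 cardF; pose tau := (n - 1 - q ^ 2 - q) %/ q.
have tauE : n - 1 - q ^ 2 - q = tau * q + (n - 1 - q ^ 2 - q) %% q by rewrite -divn_eq.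
have := ltn_pmod (n - 1 - q ^ 2 - q) q0.
move: (_ %% _) tauE => s tauE lt_sq.
have tau2 : 2 < tau.
  rewrite ltnNge; apply/negP => le2; have := leq_mul le2 (leqnn q).
  by move: (q ^ 2) (tau * q) q2 tauE => Q tq; lia.
have ltn : q ^ 2 + q + q * tau < n.
  by rewrite [q * tau]mulnC; move: (q ^ 2) (tau * q) q2 tauE => Q tq; lia.
have := @field_packing F tau n tau2; rewrite cardF => /(_ ltn).
have le_n : n <= q ^ 2 + 2 * q + tau * q.
  by move: (q ^ 2) (tau * q) q2 tauE => Q tq; lia.
have le_h : q <= 2 * q./2 + 1 by have := odd_double_half q; lia.
have := leq_mul (leqnn q) le_n; have := leq_mul (leqnn (q ^ 2)) le_h.
move: (psi'_c _) (q./2) => P h; rewrite -mulnn !expnS expn0.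
by clear; nia.
Qed.

End Assembly.

Theorem theorem4 (R : realType) :
  exists h : nat -> R, h \is 'Theta_\oo (fun n : nat => n%:R : R) /\
    forall n : nat, (8 <= n)%N ->
      2^-1 * n%:R `^ (3 / 2) + h n <= (psi'_c (complete_graph n))%:R.
Proof.
have [N psiN] := psi'_c_prime_power.
have powR32 n : n%:R `^ (3 / 2) = Num.sqrt n%:R ^+ 3 :> R.
  by rewrite mulrC powRrM powR12_sqrt // powR_mulrn // sqrtr_ge0.
exists (fun n => if (n < N)%N then - (2^-1 * n%:R `^ (3 / 2)) else - (5 / 2 * n%:R)).
split.
  apply/asboolP; exists (1, 5 / 2).
    by rewrite /= ltr01; lra.
  near=> n; have -> : (n < N)%N = false.
    by apply/negbTE; rewrite -leqNgt; near: n; exact: nbhs_infty_ge.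
  have n0 : 0 <= n%:R :> R by [].
  by rewrite normrN !ger0_norm /=; lra.
move=> n _; case: ltnP => [_|/psiN[q [q2n n_le_q psi_ge]]]; first by rewrite subrr.
rewrite powR32; set r := Num.sqrt _.
have r0 : 0 <= r by exact: sqrtr_ge0.
have nE : n%:R = r ^+ 2 :> R by rewrite sqr_sqrtr.
have q0 : 0 <= q%:R :> R by [].
have qr : q%:R <= r by rewrite -ler_sqr ?nnegrE // -nE -natrX ler_nat.
have rq : 62 / 100 * r <= q%:R.
  rewrite -ler_sqr ?nnegrE //; last by rewrite mulr_ge0 //; lra.
  have : (62 ^ 2 * n)%:R <= ((100 * q) ^ 2)%:R :> R by rewrite ler_nat.
  by rewrite !(natrX, natrM) nE; lra.
have : (2 * (q * n))%:R <= (2 * psi'_c (complete_graph n) + q ^ 3 + 5 * q ^ 2)%:R :> R.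
  by rewrite ler_nat.
rewrite !(natrD, natrX, natrM) nE.
move: (psi'_c _)%:R (q%:R) q0 qr rq => P x x0 xr rx le_P.
(* 2 x r^2 - x^3 - r^3 factors with the golden ratio as threshold for r / x *)
have : 0 <= (r - x) * (x ^+ 2 + x * r - r ^+ 2).
  apply: mulr_ge0; first by lra.
  by nra.
have : x ^+ 2 <= r ^+ 2 by nra.
nra.
Unshelve. all: by end_near.
Qed.
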